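(* Let $G$ be an additive subgroup of $\mathbb C$ with $\mathbb Z\subseteq G$ and $\frac1k\notin G$ for every integer $k>1$, let $\lambda\in\mathbb C$ and $\mathfrak g=\mathfrak g(G,\lambda)$. Let $\mathrm{Out}\,\mathfrak g$ be the group of automorphisms $\theta_\lambda(\xi,\chi,f,l,l_0,l_1,l_2,l_3)$ of $\mathfrak g$, with subgroups $T,N,S,K$, all as defined in the context. Then $$\mathrm{Out}\,\mathfrak g=T\ltimes(NSK)$$ is an (internal) semidirect product with normal subgroup $NSK$, where $T\cong\mathcal E$, $N\cong G^*$ and $S\cong\mathbb C^\times$ (so that $\mathrm{Out}\,\mathfrak g\cong\mathcal E\ltimes(G^*\,\mathbb C^\times K)$, where $G^*\,\mathbb C^\times K$ denotes $NSK$ under these identifications).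
   Context: For an additive subgroup $G\subseteq\mathbb C$ and $\lambda\in\mathbb C$, $\mathfrak g(G,\lambda)$ is the complex Lie algebra with basis $\{L_a,I_a\mid a\in G\}$ and brackets $[L_a,L_b]=(b-a)L_{a+b}$, $[L_a,I_b]=(b-\lambda a)I_{a+b}$, $[I_a,I_b]=0$. $G^*$ is the group of characters $\chi:G\to\mathbb C^\times$ with identity $\mathbf 1$; $\mathrm{Hom}(G,\mathbb C)$ is the set of additive homomorphisms $G\to\mathbb C$; $\mathcal E=\{\epsilon\in\mathbb C^\times\mid\epsilon G=G\}$, a subgroup of $\mathbb C^\times$; $\delta$ is the Kronecker delta. For $\xi\in\mathcal E$, $\chi\in G^*$, $f\in\mathrm{Hom}(G,\mathbb C)$, $l\in\mathbb C^\times$, $l_0,l_1,l_2,l_3\in\mathbb C$, $\theta_\lambda(\xi,\chi,f,l,l_0,l_1,l_2,l_3)$ is the linear map $\mathfrak g\to\mathfrak g$ with $$L_a\mapsto\xi^{-1}\chi(a)L_{\xi a}+\chi(a)\big(l_0\delta_{\lambda,0}+l_1a+l_2a^2\delta_{\lambda,-1}+l_3a^3\delta_{\lambda,-2}+f(a)\delta_{\lambda,1}\big)I_{\xi a},\qquad I_a\mapsto l\chi(a)I_{\xi a}.$$ These maps are automorphisms of $\mathfrak g$, and $\mathrm{Out}\,\mathfrak g$ denotes the set of all of them, a group under composition. Its subgroups are - $T=\{\theta_\lambda(\xi,\mathbf 1,0,1,0,0,0,0)\mid\xi\in\mathcal E\}$, - $N=\{\theta_\lambda(1,\chi,0,1,0,0,0,0)\mid\chi\in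 G^*\}$, - $S=\{\theta_\lambda(1,\mathbf 1,0,l,0,0,0,0)\mid l\in\mathbb C^\times\}$, - $K=\{\theta_\lambda(1,\mathbf 1,f,1,l_0,l_1,l_2,l_3)\mid l_0,l_1,l_2,l_3\in\mathbb C,\ f\in\mathrm{Hom}(G,\mathbb C)\}$. $NSK$ is the set of products $nsk$ with $n\in N,s\in S,k\in K$. *)

(* Defs.v *)
From HB Require Import structures.
From mathcomp Require Import all_boot all_algebra.
From mathcomp Require Import boolp classical_sets.
From mathcomp Require Import freeg ring.

Set Implicit Arguments.
Unset Strict Implicit.
Unset Printing Implicit Defensive.

Import GRing.Theory.

Local Open Scope ring_scope.

Section Subgroup.
Variables (A : groupType) (B : set A).

Definition subgrp (_ : group_closed [in B]) := {x : A | x \in B}.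

Variable hB : group_closed [in B].
HB.instance Definition _ := SubChoice.on (subgrp hB).
HB.instance Definition _ :=
  SubChoice_isSubGroup.Build A [in B] (subgrp hB) hB.
End Subgroup.

Section GroupNotions.
Local Open Scope classical_set_scope.
Local Open Scope group_scope.

Definition setmulg (A : groupType) (B D : set A) : set A :=
  [set x * y | x in B & y in D].

Definition normal_subgroup (A : groupType) (D N : set A) :=
  [/\ group_closed [in N], N `<=` D &
      forall x y, D x -> N y -> N (x * y * x^-1)].

(* Internal semidirect product D = H ⋉ N inside an ambient group. *)
Definition internal_sdprod (A : groupType) (D H N : set A) :=
  [/\ group_closed [in D], group_closed [in H] /\ H `<=` D,
      normal_subgroup D N, H `&` N = [set 1] & D = setmulg H N].

Definition iso_onto (H A : groupType) (f : H -> A) (B : set A) :=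
  [/\ {morph f : x y / x * y}, injective f & range f = B].

Record aut_action (H N : groupType) := AutAction {
  act_fun :> H -> N -> N;
  act1g : forall n, act_fun 1 n = n;
  actMg : forall h k n, act_fun (h * k) n = act_fun h (act_fun k n);
  actgM : forall h, {morph act_fun h : m n / m * n} }.

Section Sdprod.
Variables (H N : groupType) (alpha : aut_action H N).

(* The pair (h, n) stands for the product h n, and alpha h n for h n h^-1. *)
Definition sdprod (_ : aut_action H N) : Type := (H * N)%type.

HB.instance Definition _ := Choice.on (sdprod alpha).

Definition sdprod_mul (x y : sdprod alpha) : sdprod alpha :=
  (x.1 * y.1, alpha y.1^-1 x.2 * y.2).
Definition sdprod_one : sdprod alpha := (1, 1).
Definition sdprod_inv (x : sdprod alpha) : sdprod alpha :=
  (x.1^-1, alpha x.1 x.2^-1).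

Lemma act_one h : alpha h 1 = 1.
Proof. by apply: (mulgI (alpha h 1)); rewrite -actgM !mulg1. Qed.

Lemma sdprod_mulA : associative sdprod_mul.
Proof.
move=> [h m] [k n] [j p]; rewrite /sdprod_mul /= mulgA; congr pair.
by rewrite invgM actMg actgM mulgA.
Qed.
Lemma sdprod_mul1 : left_id sdprod_one sdprod_mul.
Proof. by move=> [h m]; rewrite /sdprod_mul /= act_one !mul1g. Qed.
Lemma sdprod_mulr1 : right_id sdprod_one sdprod_mul.
Proof. by move=> [h m]; rewrite /sdprod_mul /= invg1 act1g !mulg1. Qed.
Lemma sdprod_mulV : left_inverse sdprod_one sdprod_inv sdprod_mul.
Proof.
move=> [h m]; rewrite /sdprod_mul /sdprod_inv /= -actMg !mulVg act1g.
by rewrite mulVg.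
Qed.
Lemma sdprod_mulrV : right_inverse sdprod_one sdprod_inv sdprod_mul.
Proof.
move=> [h m]; rewrite /sdprod_mul /sdprod_inv /= invgK -actgM !mulgV.
by rewrite act_one.
Qed.

HB.instance Definition _ := isGroup.Build (sdprod alpha)
  sdprod_mulA sdprod_mul1 sdprod_mulr1 sdprod_mulV sdprod_mulrV.
End Sdprod.
End GroupNotions.

Section Units.
Variable F : fieldType.

Definition units := {x : F | x != 0}.
HB.instance Definition _ := SubChoice.on units.
Definition units_mul (x y : units) : units :=
  Sub (val x * val y) (mulf_neq0 (valP x) (valP y)).
Definition units_one : units := Sub 1 (oner_neq0 F).
Lemma units_inv_subproof (x : units) : (val x)^-1 != 0.
Proof. by rewrite invr_eq0 (valP x). Qed.
Definition units_inv (x : units) : units := Sub (val x)^-1 (units_inv_subproof x).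

Lemma units_mulA : associative units_mul.
Proof. by move=> x y z; apply: val_inj; rewrite /= mulrA. Qed.
Lemma units_mul1 : left_id units_one units_mul.
Proof. by move=> x; apply: val_inj; rewrite /= mul1r. Qed.
Lemma units_mulr1 : right_id units_one units_mul.
Proof. by move=> x; apply: val_inj; rewrite /= mulr1. Qed.
Lemma units_mulV : left_inverse units_one units_inv units_mul.
Proof. by move=> x; apply: val_inj; rewrite /= mulVf // (valP x). Qed.
Lemma units_mulrV : right_inverse units_one units_inv units_mul.
Proof. by move=> x; apply: val_inj; rewrite /= mulfV // (valP x). Qed.
HB.instance Definition _ := isGroup.Build units
  units_mulA units_mul1 units_mulr1 units_mulV units_mulrV.
End Units.

Section AdditiveSubgroup.
Variables (F : fieldType) (G : zmodClosed F).

Definition subg := {x : F | x \in G}.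
HB.instance Definition _ := SubChoice.on subg.
HB.instance Definition _ := [SubChoice_isSubZmodule of subg by <:].

Definition dilations : set (units F) :=
  [set e | [set val e * a | a in [set` G]] = [set` G]]%classic.

Lemma dilationsP (e : units F) :
  dilations e <-> forall a, (val e * a \in G) = (a \in G).
Proof.
split=> [eG a | eG].
  apply/idP/idP=> aG.
    have : [set` G]%classic (val e * a) by [].
    by rewrite -eG => -[b bG] /(mulfI (valP e)) <-.
  have : [set val e * a | a in [set` G]]%classic (val e * a) by exists a.
  by rewrite eG.
apply/seteqP; split=> x /=; first by case=> a aG <-; rewrite eG.
move=> xG; exists ((val e)^-1 * x); last by rewrite mulVKf // (valP e).
by rewrite /= -eG mulVKf // (valP e).
Qed.

Lemma dilations_closed : group_closed [in dilations].
Proof.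
split; first by rewrite inE; apply/dilationsP=> a; rewrite mul1r.
move=> u v; rewrite !inE => /dilationsP uG /dilationsP vG.
apply/dilationsP=> a; rewrite -mulrA uG.
by rewrite -(vG (_ * a)) mulVKf // (valP v).
Qed.

Definition dil := subgrp dilations_closed.
HB.instance Definition _ := Group.on dil.

Lemma dil_closed (e : dil) (a : subg) : val (val e) * val a \in G.
Proof. by have /set_mem/dilationsP -> := valP e; exact: (valP a). Qed.

Definition dilmul (e : dil) (a : subg) : subg := exist (fun x => x \in G) _ (dil_closed e a).

Record character := Character {
  char_fun :> subg -> units F;
  char_morph : forall a b, char_fun (a + b) = (char_fun a * char_fun b)%g }.

HB.instance Definition _ := gen_eqMixin character.
HB.instance Definition _ := gen_choiceMixin character.

Lemma character_eq (x y : character) : x =1 y -> x = y.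
Proof.
case: x y => [x hx] [y hy] /= /funext xy; subst y.
by rewrite (Prop_irrelevance hx hy).
Qed.

Lemma units_mulC (x y : units F) : (x * y = y * x)%g.
Proof. by apply: val_inj; rewrite /= mulrC. Qed.

Local Open Scope group_scope.

Lemma char_mul_subproof (x y : character) a b :
  x (a + b)%R * y (a + b)%R = (x a * y a) * (x b * y b).
Proof.
rewrite !char_morph -!mulgA; congr (_ * _); rewrite !mulgA; congr (_ * _).
exact: units_mulC.
Qed.
Definition char_mul (x y : character) := Character (char_mul_subproof x y).
Definition char_one : character :=
  @Character (fun=> 1) (fun _ _ => esym (mul1g 1)).
Lemma char_inv_subproof (x : character) a b : (x (a + b)%R)^-1 = (x a)^-1 * (x b)^-1.
Proof. by rewrite char_morph invgM units_mulC. Qed.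
Definition char_inv (x : character) := Character (char_inv_subproof x).

Lemma char_mulA : associative char_mul.
Proof. by move=> x y z; apply: character_eq => a /=; rewrite mulgA. Qed.
Lemma char_mul1 : left_id char_one char_mul.
Proof. by move=> x; apply: character_eq => a /=; rewrite mul1g. Qed.
Lemma char_mulr1 : right_id char_one char_mul.
Proof. by move=> x; apply: character_eq => a /=; rewrite mulg1. Qed.
Lemma char_mulV : left_inverse char_one char_inv char_mul.
Proof. by move=> x; apply: character_eq => a /=; rewrite mulVg. Qed.
Lemma char_mulrV : right_inverse char_one char_inv char_mul.
Proof. by move=> x; apply: character_eq => a /=; rewrite mulgV. Qed.
HB.instance Definition _ := isGroup.Build character
  char_mulA char_mul1 char_mulr1 char_mulV char_mulrV.
End AdditiveSubgroup.

HB.mixin Record Lmodule_isLie (F : fieldType) V of GRing.Lmodule F V := {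
  lie : V -> V -> V;
  lie_linearl : forall y, linear (lie^~ y);
  lie_linearr : forall x, linear (lie x);
  liexx : forall x, lie x x = 0;
  lie_jacobi : forall x y z,
    lie x (lie y z) + lie y (lie z x) + lie z (lie x y) = 0 }.

#[short(type="lieAlgType")]
HB.structure Definition LieAlgebra (F : fieldType) :=
  {V of Lmodule_isLie F V & GRing.Lmodule F V}.

Section LieAut.
Variables (F : fieldType) (g : lieAlgType F).

Record lie_aut := LieAut {
  lie_aut_fun :> g -> g;
  lie_aut_linear : linear lie_aut_fun;
  lie_aut_bij : bijective lie_aut_fun;
  lie_aut_morph : {morph lie_aut_fun : x y / lie x y} }.

HB.instance Definition _ := gen_eqMixin lie_aut.
HB.instance Definition _ := gen_choiceMixin lie_aut.

Lemma lie_aut_eq (u v : lie_aut) : u =1 v -> u = v.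
Proof.
case: u v => [u u1 u2 u3] [v v1 v2 v3] /= /funext uv; subst v.
by rewrite (Prop_irrelevance u1 v1) (Prop_irrelevance u2 v2)
  (Prop_irrelevance u3 v3).
Qed.

Definition lie_aut_one : lie_aut :=
  @LieAut idfun (fun _ _ _ => erefl) (Bijective (fun=> erefl) (fun=> erefl))
    (fun _ _ => erefl).

Lemma mul_linear (u v : lie_aut) : linear (u \o v).
Proof. by move=> c x y; rewrite /= !lie_aut_linear. Qed.
Lemma mul_morph (u v : lie_aut) : {morph u \o v : x y / lie x y}.
Proof. by move=> x y; rewrite /= !lie_aut_morph. Qed.
Definition lie_aut_mul (u v : lie_aut) : lie_aut :=
  LieAut (mul_linear u v) (bij_comp (lie_aut_bij u) (lie_aut_bij v))
    (mul_morph u v).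

Lemma lie_aut_inv_subproof (u : lie_aut) :
  exists v : lie_aut, cancel u v /\ cancel v u.
Proof.
have [v uK vK] := lie_aut_bij u.
have vl : linear v.
  by move=> c x y; apply: (bij_inj (lie_aut_bij u)); rewrite lie_aut_linear !vK.
have vm : {morph v : x y / lie x y}.
  by move=> x y; apply: (bij_inj (lie_aut_bij u)); rewrite lie_aut_morph !vK.
by exists (LieAut vl (Bijective vK uK) vm).
Qed.
Definition lie_aut_inv (u : lie_aut) : lie_aut := projT1 (cid (lie_aut_inv_subproof u)).
Lemma lie_aut_invP (u : lie_aut) : cancel u (lie_aut_inv u) /\ cancel (lie_aut_inv u) u.
Proof. exact: projT2 (cid (lie_aut_inv_subproof u)). Qed.

Lemma lie_aut_mulA : associative lie_aut_mul.
Proof. by move=> u v w; apply: lie_aut_eq. Qed.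
Lemma lie_aut_mul1 : left_id lie_aut_one lie_aut_mul.
Proof. by move=> u; apply: lie_aut_eq. Qed.
Lemma lie_aut_mulr1 : right_id lie_aut_one lie_aut_mul.
Proof. by move=> u; apply: lie_aut_eq. Qed.
Lemma lie_aut_mulV : left_inverse lie_aut_one lie_aut_inv lie_aut_mul.
Proof. by move=> u; apply: lie_aut_eq => x /=; rewrite (lie_aut_invP u).1. Qed.
Lemma lie_aut_mulrV : right_inverse lie_aut_one lie_aut_inv lie_aut_mul.
Proof. by move=> u; apply: lie_aut_eq => x /=; rewrite (lie_aut_invP u).2. Qed.
HB.instance Definition _ := isGroup.Build lie_aut
  lie_aut_mulA lie_aut_mul1 lie_aut_mulr1 lie_aut_mulV lie_aut_mulrV.
End LieAut.

Section FreeModule.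
Variables (F : fieldType) (K : choiceType).
Implicit Types x y z : {freeg K / F}.

Lemma freeg_lin_ind (P : {freeg K / F} -> Prop) :
  P 0 -> (forall c k x, P x -> P (c *: << k >> + x)) -> forall x, P x.
Proof.
move=> P0 PD x; rewrite -(freeg_sumE x).
elim: (dom x) => [|k s IH]; first by rewrite big_nil.
rewrite big_cons; have -> : << coeff k x *g k >> = coeff k x *: << k >>.
  by apply/eqP/freeg_eqP => j; rewrite coeffZ !coeffU mul1r.
exact: PD.
Qed.

Variables (M : lmodType F).

Lemma fglift_basis (f : K -> M) k : fglift f << k >> = f k.
Proof. by rewrite liftU scale1r. Qed.

Lemma fgliftD (f : K -> M) : {morph fglift f : x y / x + y}.
Proof.
have fB := lift_is_additive f.
have f0 : fglift f 0 = 0 by rewrite -[0 in LHS](subrr 0) fB subrr.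
have fN y : fglift f (- y) = - fglift f y by rewrite -[- y]sub0r fB f0 sub0r.
by move=> x y; rewrite -[in LHS](opprK y) fB fN opprK.
Qed.

Lemma fglift_linear (f : K -> M) : linear (fglift f).
Proof.
move=> c x y; rewrite fgliftD; congr (_ + _).
have f0 : fglift f 0 = 0 by apply: (addIr (fglift f 0)); rewrite -fgliftD !add0r.
elim/freeg_lin_ind: x => [|d k x IH]; first by rewrite scaler0 f0 scaler0.
rewrite scalerDr !fgliftD IH scalerDr scalerA; congr (_ + _).
have eU b : b *: (<< k >> : {freeg K / F}) = << b *g k >>.
  by apply/eqP/freeg_eqP => j; rewrite coeffZ !coeffU mul1r.
by rewrite !eU !liftU scalerA.
Qed.

Lemma linear_ext (f h : {freeg K / F} -> M) : linear f -> linear h ->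
  (forall k, f << k >> = h << k >>) -> f =1 h.
Proof.
have l0 u : linear u -> u (0 : {freeg K / F}) = 0 :> M.
  by move=> ul; have := ul (-1) 0 0; rewrite scaler0 addr0 scaleN1r addNr.
move=> fl hl fh; elim/freeg_lin_ind => [|c k x IH]; first by rewrite !l0.
by rewrite fl hl IH fh.
Qed.
End FreeModule.

(* The free F-module on the disjoint union of two copies of G: the left copy
   indexes the basis vectors L_a, the right copy the basis vectors I_a.  The
   parameter lambda is recorded because the bracket depends on it. *)
Definition galg (F : fieldType) (G : zmodClosed F) (lambda : F) : Type :=
  {freeg (subg G + subg G)%type / F}.
HB.instance Definition _ F G lambda := GRing.Lmodule.on (@galg F G lambda).

Section Algebra.
Variables (F : fieldType) (G : zmodClosed F) (lambda : F).
Local Notation g := (galg G lambda).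

Definition Lgen (a : subg G) : g := << inl a >>.
Definition Igen (a : subg G) : g := << inr a >>.

Definition basis_bracket (i j : subg G + subg G) : g :=
  match i, j with
  | inl a, inl b => (val b - val a) *: Lgen (a + b)
  | inl a, inr b => (val b - lambda * val a) *: Igen (a + b)
  | inr a, inl b => - ((val a - lambda * val b) *: Igen (b + a))
  | inr _, inr _ => 0
  end.

Definition bracket (x y : g) : g :=
  fglift (fun i => fglift (basis_bracket i) y) x.

Lemma bracket_basis i j : bracket << i >> << j >> = basis_bracket i j.
Proof. by rewrite /bracket !fglift_basis. Qed.

Lemma bracket_linearl y : linear (bracket^~ y).
Proof. exact: fglift_linear. Qed.

Lemma bracket_linearr x : linear (bracket x).
Proof.
move=> c y z; elim/freeg_lin_ind: x c y z => [|d k x IH] c y z.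
  have b0 u : bracket 0 u = 0.
    have := bracket_linearl u (-1) 0 0.
    by rewrite scaler0 addr0 scaleN1r addNr.
  by rewrite !b0 scaler0 addr0.
rewrite !bracket_linearl IH /bracket !fglift_basis fglift_linear.
by rewrite !scalerDr !scalerA [d * c]mulrC addrACA.
Qed.

Lemma basis_bracketC i j : basis_bracket i j = - basis_bracket j i.
Proof.
case: i j => a [] b /=; rewrite ?oppr0 ?opprK //.
by rewrite -scaleNr opprB [b + a]addrC.
Qed.

Lemma bracketC x y : bracket x y = - bracket y x.
Proof.
have lN (f : g -> g) : linear f -> linear (fun z => - f z).
  by move=> fl c u v; rewrite fl opprD scalerN.
move: x; apply: linear_ext; [exact: bracket_linearl|
  exact/lN/bracket_linearr|move=> i].
move: y; apply: linear_ext; [exact: bracket_linearr|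
  exact/lN/bracket_linearl|move=> j].
by rewrite !bracket_basis basis_bracketC.
Qed.

Lemma bracketxx x : bracket x x = 0.
Proof.
have b0 u : bracket 0 u = 0.
  have := bracket_linearl u (-1) 0 0.
  by rewrite scaler0 addr0 scaleN1r addNr.
elim/freeg_lin_ind: x => [|c k x IH]; first exact: b0.
rewrite bracket_linearl !bracket_linearr IH addr0 [bracket x _]bracketC.
rewrite bracket_basis scalerDr scalerN addrK.
have -> : basis_bracket k k = 0 by case: k => a //=; rewrite subrr scale0r.
by rewrite !scaler0.
Qed.

Lemma basis_jacobi i j k :
  bracket << i >> (basis_bracket j k) + bracket << j >> (basis_bracket k i) +
  bracket << k >> (basis_bracket i j) = 0.
Proof.
have bZ u c v : bracket u (c *: v) = c *: bracket u v.
  have b0 : bracket u 0 = 0.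
    have := bracket_linearr u (-1) 0 0.
    by rewrite scaler0 addr0 scaleN1r addNr.
  by have := bracket_linearr u c v 0; rewrite b0 !addr0.
have b0 u : bracket u 0 = 0 by rewrite -[0 in LHS](scale0r 0) bZ scale0r.
have bN u v : bracket u (- v) = - bracket u v.
  by rewrite -scaleN1r bZ scaleN1r.
case: i j k => a [] b [] c /=.
all: rewrite ?bN ?bZ ?b0 ?bracket_basis /= ?addr0 ?add0r ?scaler0 ?oppr0 ?addr0 //.
all: have E1 : a + (b + c) = a + b + c by rewrite addrA.
all: have E2 : b + (c + a) = a + b + c by rewrite addrA addrC addrA.
all: have E3 : b + (a + c) = a + b + c by rewrite addrCA addrA.
all: have E4 : c + (a + b) = a + b + c by rewrite addrC.
all: have E5 : a + (c + b) = a + b + c by rewrite [c + b]addrC addrA.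
all: have E6 : c + a + b = a + b + c by rewrite -addrA addrC.
all: have E7 : b + c + a = a + b + c by rewrite addrC addrA.
all: have E8 : c + (b + a) = a + b + c by rewrite addrC [b + a]addrC.
all: rewrite ?E1 ?E2 ?E3 ?E4 ?E5 ?E6 ?E7 ?E8 ?scalerN !scalerA -?scaleNr.
all: rewrite -!scalerDl [X in X *: _](_ : _ = 0) ?scale0r //; ring.
Qed.

Lemma bracket_jacobi x y z :
  bracket x (bracket y z) + bracket y (bracket z x) + bracket z (bracket x y)
  = 0.
Proof.
have lD (f h : g -> g) : linear f -> linear h ->
    linear (fun u => f u + h u).
  by move=> fl hl c u v; rewrite fl hl scalerDr addrACA.
have lC (f h : g -> g) : linear f -> linear h -> linear (f \o h).
  by move=> fl hl c u v; rewrite /= hl fl.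
have l0 : linear (fun=> 0 : g).
  by move=> c u v; rewrite scaler0 addr0.
have ll := bracket_linearl; have lr := bracket_linearr.
move: x; apply: linear_ext => //.
  apply: (lD); first apply: (lD) => //.
    by apply: (lC (bracket y) (bracket z)).
  by apply: (lC (bracket z) (bracket^~ y)).
move=> i; move: y; apply: linear_ext => //.
  apply: (lD); first apply: (lD) => //.
    by apply: (lC (bracket << i >>) (bracket^~ z)).
  by apply: (lC (bracket z) (bracket << i >>)).
move=> j; move: z; apply: linear_ext => //.
  apply: (lD); first apply: (lD) => //.
    by apply: (lC (bracket << i >>) (bracket << j >>)).
  by apply: (lC (bracket << j >>) (bracket^~ << i >>)).
  exact: ll.
by move=> k; rewrite !bracket_basis basis_jacobi.
Qed.

HB.instance Definition _ := Lmodule_isLie.Build F g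
  bracket_linearl bracket_linearr bracketxx bracket_jacobi.

Section Theta.
Variables (xi : dil G) (chi : character G) (f : {additive subg G -> F})
  (l : units F) (l0 l1 l2 l3 : F).

Definition theta_coef (a : subg G) : F :=
  l0 * (lambda == 0)%:R + l1 * val a + l2 * val a ^+ 2 * (lambda == -1)%:R
  + l3 * val a ^+ 3 * (lambda == -2%:R)%:R + f a * (lambda == 1)%:R.

Definition theta_basis (i : subg G + subg G) : g :=
  match i with
  | inl a => ((val (val xi))^-1 * val (chi a)) *: Lgen (dilmul xi a)
             + (val (chi a) * theta_coef a) *: Igen (dilmul xi a)
  | inr a => (val l * val (chi a)) *: Igen (dilmul xi a)
  end.

Definition theta_fun : g -> g := fglift theta_basis.

Lemma theta_linear : linear theta_fun.
Proof. exact: fglift_linear. Qed.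

Lemma linZ (h : g -> g) c x : linear h -> h (c *: x) = c *: h x.
Proof.
move=> hl; have h0 : h 0 = 0.
  by have := hl (-1) 0 0; rewrite scaler0 addr0 scaleN1r addNr.
by have := hl c x 0; rewrite h0 !addr0.
Qed.

Lemma linD (h : g -> g) x y : linear h -> h (x + y) = h x + h y.
Proof. by move=> hl; have := hl 1 x y; rewrite !scale1r. Qed.

Lemma thetaL a : theta_fun (Lgen a) = theta_basis (inl a).
Proof. exact: fglift_basis. Qed.

Lemma thetaI a : theta_fun (Igen a) = theta_basis (inr a).
Proof. exact: fglift_basis. Qed.

Lemma theta_coefD a b : (val b - val a) * theta_coef (a + b) =
  theta_coef b * (val b - lambda * val a)
  - theta_coef a * (val a - lambda * val b).
Proof.
have H (c w u v : F) :
    (val b - val a) * w = v * (val b - c * val a) - u * (val a - c * val b) ->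
    (val b - val a) * (w * (lambda == c)%:R) =
    v * (lambda == c)%:R * (val b - lambda * val a)
    - u * (lambda == c)%:R * (val a - lambda * val b).
  case: eqP => [->|_] /=; first by rewrite !mulr1.
  by rewrite !mulr0 !mul0r subr0.
move: H; rewrite /theta_coef (raddfD f) /= => H; rewrite !(mulrDr (_ - _)).
rewrite (H 0 l0 l0 l0); last by ring.
rewrite (H (-1) _ (l2 * sval a ^+ 2) (l2 * sval b ^+ 2)); last by ring.
rewrite (H (-2%:R) _ (l3 * sval a ^+ 3) (l3 * sval b ^+ 3)); last by ring.
rewrite (H 1 _ (f a) (f b)); last by ring.
ring.
Qed.

Lemma theta_morph : {morph theta_fun : x y / lie x y}.
Proof.
rewrite /lie /= => x y.
have ll := bracket_linearl; have lr := bracket_linearr.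
have tl := theta_linear.
have lC (h k : g -> g) : linear h -> linear k -> linear (h \o k).
  by move=> hl kl c u v; rewrite /= kl hl.
move: x; apply: linear_ext.
- by apply: (lC theta_fun (bracket^~ y)).
- by apply: (lC (bracket^~ (theta_fun y)) theta_fun).
move=> i; move: y; apply: linear_ext.
- by apply: (lC theta_fun (bracket _)).
- by apply: (lC (bracket _) theta_fun).
move=> j.
rewrite bracket_basis [in RHS]/theta_fun !fglift_basis -/theta_fun.
have brLL a b : bracket (Lgen a) (Lgen b) = (val b - val a) *: Lgen (a + b).
  exact: bracket_basis.
have brLI a b :
    bracket (Lgen a) (Igen b) = (val b - lambda * val a) *: Igen (a + b).
  exact: bracket_basis.
have brIL a b :
    bracket (Igen a) (Lgen b) = - ((val a - lambda * val b) *: Igen (b + a)).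
  exact: bracket_basis.
have brII a b : bracket (Igen a) (Igen b) = 0 by exact: bracket_basis.
have bDl u v w : bracket (u + v) w = bracket u w + bracket v w.
  by have := ll w 1 u v; rewrite !scale1r.
have bDr u v w : bracket w (u + v) = bracket w u + bracket w v.
  by have := lr w 1 u v; rewrite !scale1r.
have bZl c u w : bracket (c *: u) w = c *: bracket u w.
  exact: (linZ c u (ll w)).
have bZr c u w : bracket w (c *: u) = c *: bracket w u.
  exact: (linZ c u (lr w)).
have xiD a b : dilmul xi a + dilmul xi b = dilmul xi (a + b).
  by apply: val_inj; rewrite /= mulrDr.
have chiD a b : val (chi (a + b)) = val (chi a) * val (chi b).
  by rewrite char_morph.
have xi0 := valP (val xi).
have tZ c u : theta_fun (c *: u) = c *: theta_fun u.
  exact: (linZ c u theta_linear).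
have tN u : theta_fun (- u) = - theta_fun u by rewrite -scaleN1r tZ scaleN1r.
have t0 : theta_fun 0 = 0 by have := tZ 0 0; rewrite !scale0r.
case: i j => a [] b /=.
- rewrite tZ thetaL bDl !bDr !bZl !bZr brLL brLI brIL brII /=.
  rewrite !scaler0 addr0 [dilmul xi b + _]addrC !xiD -addrA scalerDr !scalerN !scalerA.
  rewrite -scaleNr -scalerDl; congr (_ *: _ + _ *: _); rewrite chiD /=.
    by field.
  rewrite mulrCA theta_coefD /=. by field.
- rewrite tZ thetaI bDl !bZl !bZr brLI brII /= !scaler0 addr0 xiD !scalerA.
  by congr (_ *: _); rewrite chiD /=; field.
- rewrite tN tZ thetaI bDr !bZl !bZr brIL brII /= !scaler0 addr0 xiD.
  rewrite !scalerN !scalerA; congr (- (_ *: _)); rewrite chiD /=; field.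
  exact: xi0.
by rewrite t0 !bZl !bZr brII !scaler0.
Qed.

Definition theta_inv_basis (i : subg G + subg G) : g :=
  match i with
  | inl b => let a := dilmul xi^-1%g b in
             (val (val xi) / val (chi a)) *:
               (Lgen a - (theta_coef a / val l) *: Igen a)
  | inr b => let a := dilmul xi^-1%g b in
             (val l * val (chi a))^-1 *: Igen a
  end.

Lemma theta_bij : bijective theta_fun.
Proof.
have xiK a : dilmul xi^-1%g (dilmul xi a) = a.
  by apply: val_inj; rewrite /= mulKf // (valP (val xi)).
have xiVK a : dilmul xi (dilmul xi^-1%g a) = a.
  by apply: val_inj; rewrite /= mulVKf // (valP (val xi)).
have chi0 a := valP (chi a); have l_neq0 := valP l.
have xi0 := valP (val xi).
have invl := @fglift_linear F _ g theta_inv_basis.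
have invL a : fglift theta_inv_basis (Lgen a) = theta_inv_basis (inl a).
  exact: fglift_basis.
have invI a : fglift theta_inv_basis (Igen a) = theta_inv_basis (inr a).
  exact: fglift_basis.
have lid : linear (fun x : g => x) by [].
exists (fglift theta_inv_basis).
  apply: linear_ext => // [c x y|i]; first by rewrite theta_linear invl.
  rewrite [theta_fun _]fglift_basis; case: i => a /=.
    rewrite (linD _ _ invl) !(linZ _ _ invl) invL invI /= xiK.
    rewrite scalerDr scalerN !scalerA scalerDr scalerN !scalerA -addrA -scaleNr -scalerDl.
    rewrite [X in X *: _](_ : _ = 1) ?[X in _ + X *: _](_ : _ = 0).
    - by rewrite scale1r scale0r addr0.
    - by field; rewrite l_neq0 chi0 xi0.
    - by field; rewrite chi0 xi0.
  rewrite (linZ _ _ invl) invI /= xiK scalerA mulfV ?scale1r //.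
  by apply: mulf_neq0; [exact: l_neq0|exact: chi0].
apply: (linear_ext (f := theta_fun \o fglift theta_inv_basis) (h := id)) => // [c x y|i].
  by rewrite /= invl theta_linear.
rewrite [(_ \o _) _]/= fglift_basis; case: i => b /=.
  rewrite (linZ _ _ theta_linear) (linD _ _ theta_linear) -scaleNr.
  rewrite !(linZ _ _ theta_linear) thetaL thetaI /= xiVK.
  rewrite !scalerDr !scalerA -addrA -scalerDl.
  rewrite [X in X *: _](_ : _ = 1) ?[X in _ + X *: _](_ : _ = 0).
  - by rewrite scale1r scale0r addr0.
  - by field; rewrite l_neq0 chi0.
  - by field; rewrite chi0 xi0.
rewrite (linZ _ _ theta_linear) thetaI /= xiVK scalerA mulVf ?scale1r //.
by apply: mulf_neq0; [exact: l_neq0|exact: chi0].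
Qed.

Definition theta : lie_aut g := LieAut theta_linear theta_bij theta_morph.
End Theta.

Definition add0 : {additive subg G -> F} := \0%R.

Definition thetaT (xi : dil G) := theta xi 1%g add0 1%g 0 0 0 0.
Definition thetaN (chi : character G) := theta 1%g chi add0 1%g 0 0 0 0.
Definition thetaS (l : units F) := theta 1%g 1%g add0 l 0 0 0 0.

Local Open Scope classical_set_scope.

Definition Out : set (lie_aut g) :=
  [set u | exists xi chi f l l0 l1 l2 l3, u = theta xi chi f l l0 l1 l2 l3].
Definition Tgroup : set (lie_aut g) := range thetaT.
Definition Ngroup : set (lie_aut g) := range thetaN.
Definition Sgroup : set (lie_aut g) := range thetaS.
Definition Kgroup : set (lie_aut g) :=
  [set u | exists f l0 l1 l2 l3, u = theta 1%g 1%g f 1%g l0 l1 l2 l3].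
Definition NSK : set (lie_aut g) :=
  setmulg (setmulg Ngroup Sgroup) Kgroup.
End Algebra.

Arguments Lgen {F G} lambda a.
Arguments Igen {F G} lambda a.
Arguments theta {F G} lambda xi chi f l l0 l1 l2 l3.
Arguments thetaT {F} G lambda xi.
Arguments thetaN {F} G lambda chi.
Arguments thetaS {F} G lambda l.
Arguments Out {F} G lambda _.
Arguments Tgroup {F} G lambda _.
Arguments Ngroup {F} G lambda _.
Arguments Sgroup {F} G lambda _.
Arguments Kgroup {F} G lambda _.
Arguments NSK {F} G lambda _.

(* Main.v *)
Require Import Defs.
From HB Require Import structures.
From mathcomp Require Import all_boot all_order all_algebra.
From mathcomp Require Import boolp classical_sets reals.
From mathcomp Require Import complex.
From mathcomp Require Import freeg ring.

(** Write c for the coefficient function of theta at L_a, so that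
    theta sends L_a to chi(a) (xi^-1 L_{xi a} + c(a) I_{xi a}).  Composing two
    such maps, theta after theta' ([theta_mul]), multiplies the xi's and the l's, replaces the
    characters by chi'(a) chi(xi' a), and replaces the cocycles by
    xi'^-1 c(xi' a) + l c'(a), which again lies in the span of the allowed
    terms.  Hence the maps theta form a group, and theta |-> xi is a
    homomorphism to the group of dilations.  It is well defined: since G
    contains 1, it has a nonzero element a, and xi is read off from the position
    xi a of the L-coordinate of the image of L_a; then chi and l are read off
    from coefficients ([theta_inj]).

    The maps with chi = 1, l = 1, c = 0 form a section of this homomorphism,
    with image T, and its kernel, the set of theta with xi = 1, is NSK, because
    such a theta is the product of the factors with parameters chi, l and
    l^-1 c ([NSKE]).  So the group is a split extension, which is the internal
    semidirect product ([split_internal_sdprod]); conjugation by the section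
    gives the external one ([internal_sdprod_iso]).  The isomorphisms of T, N, S
    with the groups of their parameters are the composition law restricted to
    these families, together with the uniqueness of xi, chi and l. *)

Set Implicit Arguments.
Unset Strict Implicit.
Unset Printing Implicit Defensive.

Import Order.TTheory GRing.Theory Num.Theory.
Local Open Scope ring_scope.

(** * Split extensions of subsets of a group *)

Section SplitExtension.
Local Open Scope classical_set_scope.
Local Open Scope group_scope.
Variables (H A : groupType).

Lemma morph1 (f : H -> A) : {morph f : x y / x * y} -> f 1 = 1.
Proof. by move=> fM; apply: (mulgI (f 1)); rewrite -fM !mulg1. Qed.

Lemma morphV (f : H -> A) :
  {morph f : x y / x * y} -> {morph f : x / x^-1}.
Proof. by move=> fM x; apply: (mulgI (f x)); rewrite -fM !mulgV morph1. Qed.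

Lemma range_closed (f : H -> A) :
  {morph f : x y / x * y} -> group_closed [in range f].
Proof.
move=> fM; split; first by rewrite inE; exists 1 => //; apply: morph1.
move=> u v; rewrite !inE => -[x _ <-] [y _ <-].
by exists (x * y^-1) => //; rewrite fM morphV.
Qed.

(** The relation [over h x] is the graph of a homomorphism from its domain D
    onto H, and t is a section of it; such a D splits as the image of the
    section acting on the kernel.  A relation rather than a function is used
    because D is only a subset of A. *)
Lemma split_internal_sdprod (over : H -> set A) (t : H -> A) :
    {morph t : x y / x * y} ->
    (forall h, over h (t h)) ->
    (forall h k x y, over h x -> over k y -> over (h * k) (x * y)) ->
    (forall h x, over h x -> over h^-1 x^-1) ->
    (forall h k x, over h x -> over k x -> h = k) ->
  internal_sdprod [set x | exists h, over h x] (range t) (over 1).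
Proof.
move=> tM tO oM oV oI.
have o1 : over 1 1 by rewrite -(morph1 tM).
have ker_closed : group_closed [in over 1].
  split; first by rewrite inE.
  move=> u v; rewrite !inE => /oM uM /oV/uM.
  by rewrite invg1 mulg1.
split.
- split; first by rewrite inE; exists 1.
  move=> u v; rewrite !inE => -[h hu] [k kv].
  by exists (h * k^-1); apply/oM/oV.
- by split=> [|_ [h _ <-]]; [apply: range_closed | exists h].
- split=> // [x x1|x y [h hx] y1]; first by exists 1.
  by have := oM _ _ _ _ (oM _ _ _ _ hx y1) (oV _ _ hx); rewrite mulg1 mulgV.
- apply/seteqP; split=> [x [[h _ <-] h1]|_ ->].
    by rewrite (oI _ _ _ (tO h) h1) /= morph1.
  by split=> //; exists 1 => //; apply: morph1.
apply/seteqP; split=> [x [h hx]|_ [_ [h _ <-] [y y1 <-]]].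
  exists (t h); first by exists h.
  exists ((t h)^-1 * x); last by rewrite mulVKg.
  by have := oM _ _ _ _ (oV _ _ (tO h)) hx; rewrite mulVg.
by exists (h * 1); apply: oM.
Qed.

(** Conjugation inside D by the image of H gives the action, and
    (h, n) |-> h n is injective because the two factors meet trivially. *)
Lemma internal_sdprod_iso (t : H -> A) (D T N : set A) :
    iso_onto t T -> internal_sdprod D T N ->
  exists (hN : group_closed [in N]) (alpha : aut_action H (subgrp hN)),
    (forall h n, val (alpha h n) = t h * val n * (t h)^-1) /\
    iso_onto (fun p : sdprod alpha => t p.1 * val p.2) D.
Proof.
move=> [tM tI tT] [_ [_ TD] [hN _ NJ] TN1 DE]; exists hN.
have tH h : T (t h) by rewrite -tT; exists h.
have JN h (n : subgrp hN) : t h * val n * (t h)^-1 \in N.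
  by rewrite inE; apply: NJ; [apply/TD/tH | apply/set_mem/(valP n)].
pose J h (n : subgrp hN) : subgrp hN := exist (fun x => x \in N) _ (JN h n).
have J1 n : J 1 n = n.
  by apply: val_inj; rewrite /= (morph1 tM) invg1 mulg1 mul1g.
have JM h k n : J (h * k) n = J h (J k n).
  by apply: val_inj; rewrite /= tM invgM !mulgA.
have JnM h : {morph J h : m n / m * n}.
  by move=> m n; apply: val_inj; rewrite /= !mulgA mulgVK.
exists (AutAction J1 JM JnM); split=> //; split.
- move=> [h m] [k n] /=.
  by rewrite tM (morphV tM) invgK !mulgA mulgK.
- move=> [h m] [k n] /= E.
  have : (T `&` N) (t (k^-1 * h)).
    split=> //; apply/set_mem.
    suff -> : t (k^-1 * h) = val n * (val m)^-1 by apply: hN.2; apply: valP.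
    by rewrite tM (morphV tM) -[t h](mulgK (val m)) E !mulgA mulVg mul1g.
  rewrite TN1 => /= tkh; have hk : h = k.
    by apply: (mulgI k^-1); apply: tI; rewrite tkh mulVg morph1.
  by move: E; rewrite hk => /mulgI /val_inj ->.
rewrite DE; apply/seteqP; split=> [_ [[h n] _ <-]|_ [x Tx [y Ny <-]]] /=.
  by exists (t h) => //; exists (val n) => //; apply/set_mem/(valP n).
move: Tx; rewrite -tT => -[h _ <-].
by exists (h, exist (fun z => z \in N) y (mem_set Ny)).
Qed.

End SplitExtension.

(** * Composition and uniqueness of the parameters *)

Section Dilations.
Variables (F : fieldType) (G : zmodClosed F).

Lemma dilmul_is_additive (xi : dil G) : zmod_morphism (dilmul xi).
Proof. by move=> a b; apply: val_inj; rewrite /= mulrBr. Qed.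
HB.instance Definition _ (xi : dil G) :=
  GRing.isZmodMorphism.Build _ _ (dilmul xi) (dilmul_is_additive xi).

Lemma dilmul1 (a : subg G) : dilmul 1%g a = a.
Proof. by apply: val_inj; rewrite /= mul1r. Qed.

Lemma dilmulM (xi xi' : dil G) (a : subg G) :
  dilmul (xi * xi')%g a = dilmul xi (dilmul xi' a).
Proof. by apply: val_inj; rewrite /= mulrA. Qed.

Lemma char_dil_subproof (chi : character G) (xi : dil G) a b :
  chi (dilmul xi (a + b)) = (chi (dilmul xi a) * chi (dilmul xi b))%g.
Proof. by rewrite raddfD char_morph. Qed.
Definition char_dil chi xi := Character (char_dil_subproof chi xi).

Lemma char1_dil (xi : dil G) : char_dil 1%g xi = 1%g.
Proof. exact: character_eq. Qed.

Lemma char_dil1 (chi : character G) : char_dil chi 1%g = chi.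
Proof. by apply: character_eq => a /=; rewrite dilmul1. Qed.

Lemma dil_inj_at (a : subg G) (xi xi' : dil G) :
  val a != 0 -> dilmul xi a = dilmul xi' a -> xi = xi'.
Proof.
by move=> a0 /(congr1 val) /(mulIf a0) xixi'; apply/val_inj/val_inj.
Qed.

End Dilations.

Section Theta.
Variables (F : fieldType) (G : zmodClosed F) (lambda : F).
Local Notation g := (galg G lambda).
Implicit Types (xi : dil G) (chi : character G) (f : {additive subg G -> F}).

Lemma lie_aut_basis_eq (u v : lie_aut g) :
  (forall i : subg G + subg G, u << i >> = v << i >>) -> u = v.
Proof.
move=> uv; apply: lie_aut_eq.
exact: linear_ext (lie_aut_linear u) (lie_aut_linear v) uv.
Qed.

Lemma theta_onbasis xi chi f l l0 l1 l2 l3 i :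
  theta lambda xi chi f l l0 l1 l2 l3 << i >> =
  theta_basis lambda xi chi f l l0 l1 l2 l3 i.
Proof. exact: fglift_basis. Qed.

(** The parameters l0, ..., l3, f enter only through the cocycle
    [theta_coef]; equality of automorphisms is therefore tested on it, since
    different parameters may define the same cocycle. *)
Lemma theta_ext xi chi f f' l l0 l1 l2 l3 l0' l1' l2' l3' :
    theta_coef lambda f l0 l1 l2 l3 =1 theta_coef lambda f' l0' l1' l2' l3' ->
  theta lambda xi chi f l l0 l1 l2 l3 = theta lambda xi chi f' l l0' l1' l2' l3'.
Proof.
move=> cE; apply: lie_aut_basis_eq => i.
by rewrite [LHS]theta_onbasis [RHS]theta_onbasis; case: i => a //=; rewrite cE.
Qed.

(** The composition law.  The cocycle of a composite at a is
    xi'^-1 c(xi' a) + l c'(a): each of the monomials 1, a, a^2, a^3 and each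
    additive f is mapped to one of the same kind, so the family is closed. *)
Lemma theta_mul xi chi f l l0 l1 l2 l3 xi' chi' f' l' l0' l1' l2' l3' :
  let x := val (val xi') in
  (theta lambda xi chi f l l0 l1 l2 l3
     * theta lambda xi' chi' f' l' l0' l1' l2' l3')%g =
  theta lambda (xi * xi')%g (chi' * char_dil chi xi')%g
    (x^-1 \*o (f \o dilmul xi') \+ val l \*o f') (l * l')%g
    (x^-1 * l0 + val l * l0') (l1 + val l * l1') (x * l2 + val l * l2')
    (x ^+ 2 * l3 + val l * l3').
Proof.
move=> x; have x0 : x != 0 := valP (val xi').
apply: lie_aut_basis_eq => i; rewrite [RHS]theta_onbasis.
transitivity (theta lambda xi chi f l l0 l1 l2 l3
                (theta_basis lambda xi' chi' f' l' l0' l1' l2' l3' i)).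
  by rewrite -theta_onbasis.
have tl := theta_linear (lambda := lambda) xi chi f l l0 l1 l2 l3.
case: i => a /=; last first.
  rewrite (linZ _ _ tl) thetaI /= scalerA -dilmulM.
  by congr (_ *: _); rewrite mulrACA [val l' * _]mulrC.
rewrite (linD _ _ tl) !(linZ _ _ tl).
rewrite thetaL thetaI /= -!dilmulM scalerDr !scalerA -addrA -scalerDl.
have xi0 : val (val xi) != 0 := valP (val xi).
congr (_ *: _ + _ *: _); rewrite -/x; first by field; rewrite x0.
by rewrite /theta_coef /= -/x; field.
Qed.

Lemma theta1 : theta lambda 1%g 1%g (@add0 F G) 1%g 0 0 0 0 = 1%g.
Proof.
apply: lie_aut_basis_eq => i; rewrite [LHS]theta_onbasis; case: i => a /=.
  rewrite dilmul1 invr1 !mul1r scale1r /theta_coef /=.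
  by rewrite !mul0r !addr0 scale0r addr0.
by rewrite dilmul1 mulr1 scale1r.
Qed.

Lemma coeff_thetaL xi chi f l l0 l1 l2 l3 (a b : subg G) :
  coeff (inl b) (theta lambda xi chi f l l0 l1 l2 l3 (Lgen lambda a)) =
  (val (val xi))^-1 * val (chi a) * (dilmul xi a == b)%:R.
Proof.
by rewrite /= thetaL /= coeffD !coeffZ !coeffU !mul1r /= mulr0 addr0.
Qed.

Lemma coeff_thetaI xi chi f l l0 l1 l2 l3 (a b : subg G) :
  coeff (inr b) (theta lambda xi chi f l l0 l1 l2 l3 (Igen lambda a)) =
  val l * val (chi a) * (dilmul xi a == b)%:R.
Proof. by rewrite /= thetaI /= coeffZ coeffU mul1r. Qed.

(** The image of L_a has a single nonzero L-coordinate, at xi a; this position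
    determines xi as soon as G has a nonzero element, its value then
    determines chi, and the I-coordinate of the image of I_0 determines l. *)
Lemma theta_inj (a0 : subg G) xi chi f l l0 l1 l2 l3
    xi' chi' f' l' l0' l1' l2' l3' :
    val a0 != 0 ->
    theta lambda xi chi f l l0 l1 l2 l3 =
      theta lambda xi' chi' f' l' l0' l1' l2' l3' ->
  [/\ xi = xi', chi = chi' & l = l'].
Proof.
move=> a0P E; have xiE : xi = xi'.
  have := coeff_thetaL xi chi f l l0 l1 l2 l3 a0 (dilmul xi a0).
  rewrite E coeff_thetaL eqxx mulr1.
  have [/(dil_inj_at a0P) // | _ /esym/eqP] := eqVneq (dilmul xi' a0) _.
  have xi0 : val (val xi) != 0 := valP (val xi).
  have chi0 : val (chi a0) != 0 := valP (chi a0).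
  by rewrite mulr0 mulf_eq0 invr_eq0 (negbTE xi0) (negbTE chi0).
rewrite -{}xiE in E *; have chiE : chi = chi'.
  apply: character_eq => a; apply: val_inj.
  have := coeff_thetaL xi chi f l l0 l1 l2 l3 a (dilmul xi a).
  rewrite E coeff_thetaL eqxx !mulr1 => /esym/mulfI; apply.
  by rewrite invr_eq0; exact: (valP (val xi)).
split=> //; apply: val_inj.
have := coeff_thetaI xi chi f l l0 l1 l2 l3 0 (dilmul xi 0).
rewrite E coeff_thetaI eqxx !mulr1 -chiE => /esym/mulIf; apply.
exact: (valP (chi 0)).
Qed.

(** * The subgroups of the outer group *)

Local Open Scope classical_set_scope.

Lemma thetaT_morph : {morph thetaT G lambda : x y / (x * y)%g}.
Proof.
move=> xi xi'; rewrite /thetaT theta_mul char1_dil !mul1g.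
by apply: theta_ext => a; rewrite /theta_coef /= !(mulr0, mul0r, addr0).
Qed.

Lemma thetaN_morph : {morph thetaN G lambda : x y / (x * y)%g}.
Proof.
move=> chi chi'; rewrite /thetaN theta_mul char_dil1 !mul1g.
have -> : (chi' * chi)%g = (chi * chi')%g.
  by apply: character_eq => a; apply: units_mulC.
by apply: theta_ext => a; rewrite /theta_coef /= !(mulr0, mul0r, addr0).
Qed.

Lemma thetaS_morph : {morph thetaS G lambda : x y / (x * y)%g}.
Proof.
move=> l l'; rewrite /thetaS theta_mul char1_dil !mul1g.
by apply: theta_ext => a; rewrite /theta_coef /= !(mulr0, mul0r, addr0).
Qed.

(** On K the composition law is addition of the cocycles, so the quotient of
    two elements is obtained by subtracting their parameters. *)
Lemma Kgroup_closed : group_closed [in Kgroup G lambda].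
Proof.
split; first by rewrite inE; exists (@add0 F G), 0, 0, 0, 0; rewrite theta1.
move=> u v; rewrite !inE => -[f [l0 [l1 [l2 [l3 ->]]]]].
move=> [f' [l0' [l1' [l2' [l3' ->]]]]].
exists (f \- f'), (l0 - l0'), (l1 - l1'), (l2 - l2'), (l3 - l3').
apply/(canLR (mulgK _)); rewrite theta_mul char1_dil !mul1g.
apply: theta_ext => a; rewrite /theta_coef /= dilmul1 invr1; ring.
Qed.

(** The fibre over xi of the projection from the outer group to the
    dilations.  As a relation it needs no choice of parameters, so closure under
    products and inverses can be stated fibre by fibre. *)
Definition theta_over xi : set (lie_aut g) := [set u |
  exists chi f l l0 l1 l2 l3, u = theta lambda xi chi f l l0 l1 l2 l3].

Lemma theta_over_mul xi xi' u v :
  theta_over xi u -> theta_over xi' v -> theta_over (xi * xi')%g (u * v)%g.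
Proof.
move=> [chi [f [l [l0 [l1 [l2 [l3 ->]]]]]]].
move=> [chi' [f' [l' [l0' [l1' [l2' [l3' ->]]]]]]].
by rewrite theta_mul; do 7! eexists.
Qed.

(** The inverse has cocycle - l^-1 xi c(xi^-1 a): this is the c' for which the
    cocycle of the composite, at xi' = xi^-1, vanishes. *)
Lemma theta_over_inv xi u : theta_over xi u -> theta_over xi^-1%g u^-1%g.
Proof.
move=> [chi [f [l [l0 [l1 [l2 [l3 ->]]]]]]].
pose x := val (val xi); pose k := (val l)^-1.
exists (char_dil chi xi^-1)^-1%g, ((- k * x) \*o (f \o dilmul xi^-1%g)), l^-1%g.
exists (- k * x * l0), (- k * l1), (- k * x^-1 * l2), (- k * x^-1 ^+ 2 * l3).
apply: (mulgI (theta lambda xi chi f l l0 l1 l2 l3)).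
rewrite mulgV -theta1 theta_mul !mulgV mulVg.
have x0 : x != 0 := valP (val xi).
have l_neq0 : val l != 0 := valP l.
by apply: theta_ext => a; rewrite /theta_coef /k /= -/x invrK; field; rewrite x0 andbT.
Qed.

Lemma theta_over_inj (a0 : subg G) xi xi' u : val a0 != 0 ->
  theta_over xi u -> theta_over xi' u -> xi = xi'.
Proof.
move=> a0P [chi [f [l [l0 [l1 [l2 [l3 ->]]]]]]].
by move=> [chi' [f' [l' [l0' [l1' [l2' [l3' /(theta_inj a0P)[]]]]]]]].
Qed.

Lemma OutE : Out G lambda = [set u | exists xi, theta_over xi u].
Proof. by []. Qed.

(** Splitting off N and S divides the cocycle by l, because the composite
    (n s) k multiplies the cocycle of k by the scalar of s. *)
Lemma NSKE : NSK G lambda = theta_over 1%g.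
Proof.
apply/seteqP; split.
  move=> u [v [n [chi _ <-] [s [l _ <-] <-]]].
  move=> [k [f [l0 [l1 [l2 [l3 ->]]]]] <-].
  have over1M x y : theta_over 1%g x -> theta_over 1%g y ->
      theta_over 1%g (x * y)%g.
    by move=> x1 /(theta_over_mul x1); rewrite mul1g.
  by apply/over1M; [apply/over1M|]; do 7! eexists.
move=> u [chi [f [l [l0 [l1 [l2 [l3 ->]]]]]]]; pose k := (val l)^-1.
exists (thetaN G lambda chi * thetaS G lambda l)%g.
  by exists (thetaN G lambda chi); [exists chi|exists (thetaS G lambda l); [exists l|]].
exists (theta lambda 1%g 1%g (k \*o f) 1%g (k * l0) (k * l1) (k * l2) (k * l3)).
  by exists (k \*o f), (k * l0), (k * l1), (k * l2), (k * l3).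
rewrite /thetaN /thetaS !theta_mul !char_dil1 !mul1g !mulg1.
have l_neq0 : val l != 0 := valP l.
by apply: theta_ext => a; rewrite /theta_coef /k /= invr1; field.
Qed.

Section Nontrivial.
Variables (a0 : subg G) (a0P : val a0 != 0).

Lemma thetaT_iso : iso_onto (thetaT G lambda) (Tgroup G lambda).
Proof. by split=> //; [exact: thetaT_morph|move=> x y /(theta_inj a0P)[]]. Qed.

Lemma thetaN_iso : iso_onto (thetaN G lambda) (Ngroup G lambda).
Proof. by split=> //; [exact: thetaN_morph|move=> x y /(theta_inj a0P)[]]. Qed.

Lemma thetaS_iso : iso_onto (thetaS G lambda) (Sgroup G lambda).
Proof. by split=> //; [exact: thetaS_morph|move=> x y /(theta_inj a0P)[]]. Qed.

Lemma Out_sdprod :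
  internal_sdprod (Out G lambda) (Tgroup G lambda) (NSK G lambda).
Proof.
rewrite OutE NSKE; apply: split_internal_sdprod.
- exact: thetaT_morph.
- by move=> xi; do 7! eexists.
- exact: theta_over_mul.
- exact: theta_over_inv.
by move=> xi xi' u; apply: theta_over_inj a0P.
Qed.

End Nontrivial.
End Theta.

Theorem theorem4p3 (R : realType) (G : zmodClosed R[i]) (lambda : R[i])
    (hZ : forall k : int, k%:~R \in G)
    (hG : forall k : int, 1 < k -> (k%:~R)^-1 \notin G) :
  [/\ (* T, N, S, K are subgroups of Out, which is T ⋉ NSK *)
      [/\ group_closed [in Tgroup G lambda], group_closed [in Ngroup G lambda],
          group_closed [in Sgroup G lambda] & group_closed [in Kgroup G lambda]],
      internal_sdprod (Out G lambda) (Tgroup G lambda) (NSK G lambda),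
      [/\ iso_onto (thetaT G lambda) (Tgroup G lambda),
          iso_onto (thetaN G lambda) (Ngroup G lambda) &
          iso_onto (thetaS G lambda) (Sgroup G lambda)] &
      exists (hNSK : group_closed [in NSK G lambda])
             (alpha : aut_action (dil G) (subgrp hNSK)),
        (forall xi n, val (alpha xi n) =
           (thetaT G lambda xi * val n * (thetaT G lambda xi)^-1)%g) /\
        iso_onto (fun p : sdprod alpha => (thetaT G lambda p.1 * val p.2)%g)
          (Out G lambda)].
Proof.
pose a0 : subg G := exist (fun x => x \in G) 1%:~R (hZ 1).
have a0P : val a0 != 0 by rewrite /= mulr1z oner_neq0.
split.
- split; last exact: Kgroup_closed.
  + exact: range_closed (@thetaT_morph _ G lambda).
  + exact: range_closed (@thetaN_morph _ G lambda).
  + exact: range_closed (@thetaS_morph _ G lambda).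
- exact (Out_sdprod lambda a0P).
- split; [exact (thetaT_iso lambda a0P)|exact (thetaN_iso lambda a0P)|exact (thetaS_iso lambda a0P)].
exact (internal_sdprod_iso (thetaT_iso lambda a0P) (Out_sdprod lambda a0P)).
Qed.
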